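(* Let $\Omega=\{(x,y)\in\mathbb{R}^2 : x>0,\ y<0\}$ be the fourth quadrant and let $\varphi:\Omega\to\mathbb{R}^2_+$ be the map $$\varphi(x,y)=\left(e^{x+y},\ \sqrt{(e^{2x}-1)(1-e^{2y})}\right).$$ Then $\varphi$ is surjective, and it maps the rays $x=\mathrm{const}$ in $\Omega$ to arcs of ellipses with foci $F_1$ and $F_2$, the rays $y=\mathrm{const}$ in $\Omega$ to arcs of hyperbolas with foci $F_1$ and $F_2$, the intervals $x-y=\mathrm{const}$ in $\Omega$ to arcs of circles of the hyperbolic Apollonian pencil of $F_1,F_2$, and the rays $x+y=\mathrm{const}$ in $\Omega$ to vertical lines (restricted to $\mathbb{R}^2_+$).
   Context: $\mathbb{R}^2_+=\{(s,t)\in\mathbb{R}^2: s>0,\ t>0\}$ is the (open) positive quadrant. The foci are $F_1=(-1,0)$ and $F_2=(1,0)$. The elliptic Apollonian pencil of $F_1,F_2$ is the family of circles passing through both $F_1$ and $F_2$. The hyperbolic Apollonian pencil of $F_1,F_2$ is the family of circles orthogonal to all circles of the elliptic pencil; each of its circles is a locus of points $X$ with $|XF_1|/|XF_2|=\mathrm{const}$. An ellipse with foci $F_1,F_2$ is a locus $|XF_1|+|XF_2|=\mathrm{const}$ with constant greater than $2$; a branch of a hyperbola with foci $F_1,F_2$ is a locus $|XF_1|-|XF_2|=\mathrm{const}$ (in $\mathbb{R}^2_+$ this difference lies in $(0,2)$). *)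

(* Defs.v *)
From HB Require Import structures.
From mathcomp Require Import all_boot all_order all_algebra.
From mathcomp Require Import all_classical all_reals all_analysis.
Set Implicit Arguments.
Unset Strict Implicit.
Unset Printing Implicit Defensive.
Import Order.TTheory GRing.Theory Num.Theory.
Import numFieldNormedType.Exports.
Local Open Scope classical_set_scope.
Local Open Scope ring_scope.

Section Plane.
Variable R : realType.
Implicit Types (p q m : R * R) (r : R) (A C : set (R * R)).

Definition quadrant : set (R * R) := [set p | 0 < p.1 /\ 0 < p.2].

Definition Omega : set (R * R) := [set p | 0 < p.1 /\ p.2 < 0].

Definition phi p : R * R :=
  (expR (p.1 + p.2),
   Num.sqrt ((expR (2 * p.1) - 1) * (1 - expR (2 * p.2)))).

(* The norm of the library on [R * R] is the sup norm, hence an explicit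
   Euclidean distance; the two norms induce the same topology. *)
Definition dist p q : R :=
  Num.sqrt ((p.1 - q.1) ^+ 2 + (p.2 - q.2) ^+ 2).

Definition F1 : R * R := (-1, 0).
Definition F2 : R * R := (1, 0).

Definition is_ellipse C : Prop :=
  exists2 k : R, 2 < k & C = [set p | dist p F1 + dist p F2 = k].

(* The sign of [k] selects the branch; [k = 0] (the perpendicular bisector of
   the foci) and [|k| = 2] (two rays of the focal axis) are excluded. *)
Definition is_hyperbola_branch C : Prop :=
  exists2 k : R, 0 < `|k| < 2 & C = [set p | dist p F1 - dist p F2 = k].

Definition circle m r : set (R * R) := [set p | dist p m = r].

Definition in_elliptic_pencil m r : Prop :=
  [/\ 0 < r, circle m r F1 & circle m r F2].

(* The circles meet, and at each common point their radii, hence their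
   tangents, are perpendicular. *)
Definition orthogonal_circles m r m' r' : Prop :=
  circle m r `&` circle m' r' !=set0 /\
  forall p, (circle m r `&` circle m' r') p ->
    (p.1 - m.1) * (p.1 - m'.1) + (p.2 - m.2) * (p.2 - m'.2) = 0.

Definition is_hyperbolic_pencil_circle C : Prop :=
  exists m r, [/\ 0 < r, C = circle m r &
    forall m' r', in_elliptic_pencil m' r' -> orthogonal_circles m r m' r'].

Definition vertical_line (a : R) : set (R * R) := [set p | p.1 = a].

(* A connected part of the curve [C], neither empty, nor a single point, nor
   all of [C]. *)
Definition is_arc_of C A : Prop :=
  [/\ A `<` C, connected A & exists p q, [/\ A p, A q & p <> q]].

(* [A] is an arc of [C], namely the one cut out by the open quadrant. *)
Definition is_quadrant_arc_of C A : Prop :=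
  is_arc_of C A /\ A = C `&` quadrant.

End Plane.

Arguments quadrant {R}.
Arguments Omega {R}.

(* Main.v *)
Require Import Defs.
From mathcomp Require Import all_boot all_order all_algebra.
From mathcomp Require Import all_classical all_reals all_analysis.
From mathcomp Require Import ring lra.
Import Order.TTheory GRing.Theory Num.Theory.
Import numFieldNormedType.Exports.
Local Open Scope classical_set_scope.
Local Open Scope ring_scope.

(** Put [a = expR x] and [b = expR y], so that [a > 1] and [0 < b < 1] on
    [Omega].  The point [X = phi (x, y)] has abscissa [a * b] and squared
    ordinate [(a ^+ 2 - 1) * (1 - b ^+ 2)], and the squared distances to the
    foci are perfect squares: [|X F1| = a + b] and [|X F2| = a - b]
    ([dist_phi_F1], [dist_phi_F2]).  So [a] and [b] are the half sum and the
    half difference of the focal distances, that is, elliptic coordinates on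
    the quadrant.  This gives injectivity at once, and surjectivity
    ([phi_surj]) by taking logarithms of these half sum and half difference.

    Each family of lines in [Omega] fixes one function of [a] and [b]: the sum
    of the focal distances [2 * a] for [x = c], their difference [2 * b] for
    [y = c], the ratio [a / b], hence the ratio of the focal distances, for
    [x - y = c], and the abscissa [a * b] for [x + y = c].  In each case the
    image is exactly the part in the quadrant of the corresponding curve.

    For the first three families it remains to see that this part is an arc
    ([quadrant_arc]): it is connected as a continuous image of an interval, it
    has two points because [phi] is injective, and it is not the whole curve
    because the curve is symmetric about the focal axis.  For the third family,
    the circle of ratio [(q + 1) / (q - 1)] with [q = expR c] has centre
    [(cosh c, 0)] and radius [sinh c]; a circle centred at [(a, 0)] with radius
    [r] belongs to the hyperbolic pencil as soon as [a ^+ 2 = r ^+ 2 + 1]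
    ([hyperbolic_pencil_circleP]). *)

Section EllipticCoordinates.
Set Implicit Arguments.
Unset Strict Implicit.
Variable R : realType.
Implicit Types (p q m : R * R) (C L : set (R * R)).

(** * Focal distances of [phi p] *)

Lemma dist_ge0 p q : 0 <= dist p q.
Proof. exact: sqrtr_ge0. Qed.

Lemma sqr_dist p q : dist p q ^+ 2 = (p.1 - q.1) ^+ 2 + (p.2 - q.2) ^+ 2.
Proof. by rewrite sqr_sqrtr // addr_ge0 // sqr_ge0. Qed.

Lemma dist_eq p q (d : R) : 0 <= d ->
  (dist p q = d) <-> ((p.1 - q.1) ^+ 2 + (p.2 - q.2) ^+ 2 = d ^+ 2).
Proof.
move=> d0; split=> [<-|E]; first by rewrite sqr_dist.
by rewrite /dist E sqrtr_sqr ger0_norm.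
Qed.

Lemma Omega_expR p : Omega p -> 1 < expR p.1 /\ 0 < expR p.2 < 1.
Proof. by case=> p1 p2; rewrite expR_gt1 expR_gt0 expR_lt1. Qed.

Lemma phi_radicand p : (expR (2 * p.1) - 1) * (1 - expR (2 * p.2)) =
  (expR p.1 ^+ 2 - 1) * (1 - expR p.2 ^+ 2).
Proof. by rewrite -!expRM_natl. Qed.

Lemma phi_radicand_gt0 p : Omega p ->
  0 < (expR p.1 ^+ 2 - 1) * (1 - expR p.2 ^+ 2).
Proof.
move=> /Omega_expR [a1 /andP [b0 b1]].
by apply: mulr_gt0; nra.
Qed.

Lemma phi1 p : (phi p).1 = expR p.1 * expR p.2.
Proof. by rewrite /phi /= expRD. Qed.

Lemma sqr_phi2 p : Omega p ->
  (phi p).2 ^+ 2 = (expR p.1 ^+ 2 - 1) * (1 - expR p.2 ^+ 2).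
Proof.
by move=> Op; rewrite /phi /= phi_radicand sqr_sqrtr // ltW // phi_radicand_gt0.
Qed.

Lemma phi_quadrant p : Omega p -> quadrant (phi p).
Proof.
move=> Op; split; rewrite /phi /= ?expR_gt0 //.
by rewrite phi_radicand sqrtr_gt0 phi_radicand_gt0.
Qed.

(** [(a * b + 1) ^+ 2 + (a ^+ 2 - 1) * (1 - b ^+ 2) = (a + b) ^+ 2]; the other
    focus is the same identity with [b] replaced by [- b]. *)
Lemma dist_phi_F1 p : Omega p -> dist (phi p) (F1 R) = expR p.1 + expR p.2.
Proof.
move=> Op; apply/dist_eq; first by rewrite addr_ge0 // expR_ge0.
by rewrite phi1 /= subr0 sqr_phi2 //; ring.
Qed.

Lemma dist_phi_F2 p : Omega p -> dist (phi p) (F2 R) = expR p.1 - expR p.2.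
Proof.
move=> Op; have [a1 /andP [_ b1]] := Omega_expR Op.
apply/dist_eq; first by lra.
by rewrite phi1 /= subr0 sqr_phi2 //; ring.
Qed.

(** * Bijectivity onto the quadrant *)

Lemma phi_inj : {in Omega &, injective (@phi R)}.
Proof.
move=> p q; rewrite !inE => Op Oq E.
have e1 := dist_phi_F1 Op; have e2 := dist_phi_F2 Op.
rewrite E dist_phi_F1 // in e1; rewrite E dist_phi_F2 // in e2.
have /expR_inj h1 : expR p.1 = expR q.1 by lra.
have /expR_inj h2 : expR p.2 = expR q.2 by lra.
by rewrite (surjective_pairing p) h1 h2 -surjective_pairing.
Qed.

(** The preimage is read off the focal distances.  It lies in [Omega] because
    [0 <= a], [b <= a] and the positivity of [a * b = s] and of
    [(a ^+ 2 - 1) * (1 - b ^+ 2) = t ^+ 2] force [0 < b < 1 < a]. *)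
Lemma phi_surj : set_surj Omega quadrant (@phi R).
Proof.
move=> [s t] [/= s0 t0].
pose a : R := (dist (s, t) (F1 R) + dist (s, t) (F2 R)) / 2.
pose b : R := (dist (s, t) (F1 R) - dist (s, t) (F2 R)) / 2.
have d1 := sqr_dist (s, t) (F1 R); have d2 := sqr_dist (s, t) (F2 R).
have d10 := dist_ge0 (s, t) (F1 R); have d20 := dist_ge0 (s, t) (F2 R).
rewrite /= in d1 d2.
have ab : a * b = s by rewrite /a /b; nra.
have rad : (a ^+ 2 - 1) * (1 - b ^+ 2) = t ^+ 2.
  transitivity (a ^+ 2 + b ^+ 2 - 1 - (a * b) ^+ 2); first by ring.
  by rewrite ab /a /b; nra.
have a_ge0 : 0 <= a by rewrite /a; lra.
have ba : b <= a by rewrite /a /b; lra.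
have b0 : 0 < b by nra.
have t20 : 0 < t ^+ 2 by rewrite exprn_gt0.
have a1 : 1 < a.
  rewrite ltNge; apply/negP => a1.
  (* If a <= 1 then b <= 1 too, so the product is not positive. *)
  have : (a ^+ 2 - 1) * (1 - b ^+ 2) <= 0 by apply: mulr_le0_ge0; nra.
  by rewrite rad leNgt t20.
have b1 : b < 1.
  have a21 : 0 < a ^+ 2 - 1 by nra.
  by move: t20; rewrite -rad pmulr_rgt0 // => ?; nra.
have a0 : 0 < a by lra.
have Oab : Omega (ln a, ln b) by split; rewrite /= ?ln_gt0 // ln_lt0 // b0.
exists (ln a, ln b) => //.
apply/pair_equal_spec; split; first by rewrite expRD !lnK ?posrE.
by rewrite phi_radicand /= !lnK ?posrE // rad sqrtr_sqr gtr0_norm.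
Qed.

(** * Arcs cut out by the quadrant *)

Lemma continuous_pair (T : topologicalType) (f g : T -> R) :
  continuous f -> continuous g -> continuous (fun x => (f x, g x)).
Proof.
by move=> cf cg x; apply: (@cvg_pair _ _ _ _ (nbhs (f x)) (nbhs (g x)));
  [exact: cf|exact: cg].
Qed.

Lemma continuous_phi : continuous (@phi R).
Proof.
have c1 : continuous (fun p : R * R => p.1) by move=> p; exact: cvg_fst.
have c2 : continuous (fun p : R * R => p.2) by move=> p; exact: cvg_snd.
have cexp (f : R * R -> R) : continuous f -> continuous (fun p => expR (f p)).
  by move=> cf p; apply: continuous_cvg; [exact: continuous_expR|exact: cf].
apply: continuous_pair => /= [|p].
  by apply: cexp => q; apply: cvgD; [exact: c1|exact: c2].
apply: (continuous_cvg _ (@sqrt_continuous _ _)).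
apply: cvgM; apply: cvgB; try exact: cvg_cst.
  by apply: (cexp (fun p => 2 * p.1)) => q; apply: cvgM; [exact: cvg_cst|exact: c1].
by apply: (cexp (fun p => 2 * p.2)) => q; apply: cvgM; [exact: cvg_cst|exact: c2].
Qed.

(** Since [phi] maps [Omega] onto the quadrant, describing [C] in the
    coordinates of [Omega] is enough to identify [phi @` L] with the part of
    [C] in the quadrant.  The symmetry of [C] about the focal axis provides
    points of [C] below that axis, so that this part is proper. *)
Lemma quadrant_arc C L :
  L `<=` Omega -> connected L -> (exists p q, [/\ L p, L q & p <> q]) ->
  (forall p, C p -> C (p.1, - p.2)) ->
  (forall p, Omega p -> C (phi p) <-> L p) ->
  is_quadrant_arc_of C (@phi R @` L).
Proof.
move=> LO cL [p [q [Lp Lq pq]]] Csym CL.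
have E : @phi R @` L = C `&` quadrant.
  apply/seteqP; split=> [_ [r Lr <-]|t [Ct /phi_surj [r Or rt]]].
    by split; [apply/CL => //; exact: LO|apply: phi_quadrant; exact: LO].
  by exists r => //; apply/(CL _ Or); rewrite rt.
split=> //; split.
- split; first by rewrite E; exact: subIsetl.
  move=> sub; have [Cp [_ p2]] : (C `&` quadrant) (phi p) by rewrite -E; exists p.
  have := sub _ (Csym _ Cp).
  by rewrite E => -[_ [_ /=]]; rewrite oppr_gt0 ltNge (ltW p2).
- apply: connected_continuous_connected => //.
  exact: (continuous_subspaceT continuous_phi).
- exists (phi p), (phi q); split; [exact: imageP|exact: imageP|].
  by move=> /phi_inj; rewrite !inE => /(_ (LO _ Lp) (LO _ Lq)).
Qed.

Lemma connected_image_itv (i : interval R) (g : R -> R * R) :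
  continuous g -> connected (g @` [set` i]).
Proof.
move=> cg; apply: connected_continuous_connected.
  by apply/connected_intervalP; exact: interval_is_interval.
exact: continuous_subspaceT.
Qed.

Lemma dist_reflect p q : q.2 = 0 -> dist (p.1, - p.2) q = dist p q.
Proof. by move=> q2; rewrite /dist /= q2 !subr0 sqrrN. Qed.

(** * Rays to ellipses and hyperbolas *)

Lemma vertical_ray_arc (c : R) : 0 < c ->
  exists2 C, is_ellipse C &
    is_quadrant_arc_of C (@phi R @` [set p | Omega p /\ p.1 = c]).
Proof.
move=> c0; exists [set p | dist p (F1 R) + dist p (F2 R) = 2 * expR c].
  by exists (2 * expR c) => //; rewrite ltr_pMr ?ltr0n // expR_gt1.
apply: quadrant_arc => [p []//||||p Op].
- have -> : [set p : R * R | Omega p /\ p.1 = c] =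
      (fun y => (c, y)) @` [set` `]-oo, 0[].
    apply/seteqP; split=> [[x y] [[/= _ y0] ->]|_ [y + <-]].
      by exists y => //=; rewrite in_itv.
    by rewrite /= in_itv /=.
  apply: connected_image_itv; apply: continuous_pair => y //.
  exact: cvg_cst.
- by exists (c, -1), (c, -2); split; [split=> //; split=> /=; lra..|case; lra].
- by move=> p; rewrite /= !dist_reflect.
- rewrite /= dist_phi_F1 // dist_phi_F2 //; split=> [E|[_ <-]]; last by ring.
  by split=> //; apply: expR_inj; lra.
Qed.

Lemma horizontal_ray_arc (c : R) : c < 0 ->
  exists2 C, is_hyperbola_branch C &
    is_quadrant_arc_of C (@phi R @` [set p | Omega p /\ p.2 = c]).
Proof.
move=> c0; exists [set p | dist p (F1 R) - dist p (F2 R) = 2 * expR c].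
  have e0 := expR_gt0 c; have e1 : expR c < 1 by rewrite expR_lt1.
  by exists (2 * expR c) => //; rewrite gtr0_norm; lra.
apply: quadrant_arc => [p []//||||p Op].
- have -> : [set p : R * R | Omega p /\ p.2 = c] =
      (fun x => (x, c)) @` [set` `]0, +oo[].
    apply/seteqP; split=> [[x y] [[/= x0 _] ->]|_ [x + <-]].
      by exists x => //=; rewrite in_itv /= andbT.
    by rewrite /= in_itv /= andbT.
  apply: connected_image_itv; apply: continuous_pair => x //.
  exact: cvg_cst.
- by exists (1, c), (2, c); split; [split=> //; split=> /=; lra..|case; lra].
- by move=> p; rewrite /= !dist_reflect.
- rewrite /= dist_phi_F1 // dist_phi_F2 //; split=> [E|[_ <-]]; last by ring.
  by split=> //; apply: expR_inj; lra.
Qed.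

(** * Segments to circles of the hyperbolic pencil *)

(** A circle through both foci has centre [(0, k)] and radius
    [Num.sqrt (1 + k ^+ 2)].  In terms of [x ^+ 2 + y ^+ 2], the two circles
    read [x ^+ 2 + y ^+ 2 = 2 * a * x - 1] and
    [x ^+ 2 + y ^+ 2 = 1 + 2 * k * y]: the sum of these equations is twice the
    orthogonality relation, and their difference is the radical axis
    [a * x - k * y = 1], on which a common point is exhibited. *)
Lemma hyperbolic_pencil_circleP (a r : R) : 0 < r -> a ^+ 2 = r ^+ 2 + 1 ->
  is_hyperbolic_pencil_circle (circle (a, 0) r).
Proof.
move=> r0 ar; exists (a, 0), r; split=> // -[u k] r' [r'0].
move=> /(dist_eq _ _ (ltW r'0)) /= h1 /(dist_eq _ _ (ltW r'0)) /= h2.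
have u0 : u = 0 by lra.
subst u; split.
(* The common point is the foot (a, - k) / N of the perpendicular from the
   origin to the radical axis, moved by t along the direction (k, a); t is
   the larger root of N t^2 - 2 k a t + 1 / N - 1 + 2 k^2 / N = 0, whose
   reduced discriminant is D^2. *)
- pose N := a ^+ 2 + k ^+ 2.
  have N0 : 0 < N by rewrite /N ar; nra.
  pose D := Num.sqrt (k ^+ 2 + 1) * r.
  have D2 : D ^+ 2 = (k ^+ 2 + 1) * r ^+ 2.
    by rewrite exprMn sqr_sqrtr // addr_ge0 // sqr_ge0.
  pose t := (k * a + D) / N.
  pose x := a / N + t * k; pose y := t * a - k / N.
  have N_neq0 : N != 0 by rewrite gt_eqF.
  have lin : a * x - k * y = 1.
    by rewrite /x /y; transitivity ((a ^+ 2 + k ^+ 2) / N); [field|rewrite divff].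
  have quad : x ^+ 2 + y ^+ 2 = 1 + 2 * k * y.
    have e1 : x ^+ 2 + y ^+ 2 = (1 + (k * a + D) ^+ 2) / N.
      transitivity ((1 + (t * N) ^+ 2) / N); last by rewrite /t divfK.
      transitivity ((a ^+ 2 + k ^+ 2) / N ^+ 2 + t ^+ 2 * (a ^+ 2 + k ^+ 2)).
        by rewrite /x /y; field.
      by rewrite -/N; field.
    have e2 : y = (a * (k * a + D) - k) / N by rewrite /y /t; ring.
    have : 1 + (k * a + D) ^+ 2 - N - 2 * k * (a * (k * a + D) - k) = 0.
      transitivity (1 - k ^+ 2 * a ^+ 2 + D ^+ 2 - N + 2 * k ^+ 2); first by ring.
      by rewrite D2 /N ar; ring.
    rewrite e1 e2 => h; apply: (mulIf N_neq0).
    by rewrite divfK // mulrDl mul1r -[_ * (_ / N) * N]mulrA divfK //; lra.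
  exists (x, y); split; apply/dist_eq; rewrite /= ?ltW //; lra.
- move=> [x y] [/(dist_eq _ _ (ltW r0)) /= ? /(dist_eq _ _ (ltW r'0)) /= ?].
  by rewrite /=; lra.
Qed.

(** With [q = expR c], the equation of the circle evaluated at [phi p] factors
    as [(a - q * b) * (a - q^-1 * b) = 0].  The second factor is positive
    because [b < 1 < a] and [q^-1 < 1], so the circle is [a = q * b]. *)
Lemma diagonal_segment_arc (c : R) : 0 < c ->
  exists2 C, is_hyperbolic_pencil_circle C &
    is_quadrant_arc_of C (@phi R @` [set p | Omega p /\ p.1 - p.2 = c]).
Proof.
move=> c0; pose q := expR c; have q1 : 1 < q by rewrite expR_gt1.
have q0 : q != 0 by rewrite gt_eqF // expR_gt0.
have qV1 : q^-1 < 1 by rewrite invf_lt1 // expR_gt0.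
exists (circle ((q + q^-1) / 2, 0) ((q - q^-1) / 2)).
  by apply: hyperbolic_pencil_circleP; [lra|field].
apply: quadrant_arc => [p []//||||p Op].
- have -> : [set p : R * R | Omega p /\ p.1 - p.2 = c] =
      (fun x => (x, x - c)) @` [set` `]0, c[].
    apply/seteqP; split=> [[x y] [[/= x0 y0] xy]|_ [x + <-]].
      by exists x => /=; [rewrite in_itv /=; lra|congr pair; lra].
    by rewrite /= in_itv /= => /andP [? ?]; split; [split=> /=|]; lra.
  apply: connected_image_itv; apply: continuous_pair => x //.
  by apply: cvgB => //; exact: cvg_cst.
- exists (c / 2, - (c / 2)), (c / 3, c / 3 - c).
  by split; [split; [split=> /=|rewrite /=]; lra..|case; lra].
- by move=> p; rewrite /circle /= !dist_reflect.
- have [a1 /andP [b0 b1]] := Omega_expR Op.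
  have qE : (expR p.1 = q * expR p.2) <-> p.1 - p.2 = c.
    by rewrite /q -expRD; split=> [/expR_inj|<-]; [lra|congr expR; lra].
  have r0 : 0 <= (q - q^-1) / 2 by lra.
  rewrite /circle /= (dist_eq _ _ r0) phi1 /= subr0 sqr_phi2 //.
  set a := expR p.1 in qE a1 *; set b := expR p.2 in qE b0 b1 *.
  have fE : (a * b - (q + q^-1) / 2) ^+ 2 + (a ^+ 2 - 1) * (1 - b ^+ 2)
      - ((q - q^-1) / 2) ^+ 2 = (a - q * b) * (a - q^-1 * b) by field.
  have ab : a - q^-1 * b != 0 by rewrite gt_eqF //; nra.
  split=> [E|[_ /qE E]].
    split=> //; apply/qE/eqP; move: fE; rewrite E subrr => /esym/eqP.
    by rewrite mulf_eq0 (negbTE ab) orbF subr_eq0.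
  by apply/eqP; rewrite -subr_eq0 fE -E subrr mul0r.
Qed.

(** * Rays to vertical lines *)

Lemma antidiagonal_ray_image (c : R) :
  @phi R @` [set p | Omega p /\ p.1 + p.2 = c] =
    vertical_line (expR c) `&` quadrant.
Proof.
apply/seteqP; split=> [_ [p [Op <-] <-]|t [ct /phi_surj [p Op pt]]].
  by split; last exact: phi_quadrant.
by exists p => //; split=> //; apply: expR_inj; rewrite -ct -pt.
Qed.

End EllipticCoordinates.

Theorem theorem3 (R : realType) :
  (set_fun Omega quadrant (@phi R) /\ set_surj Omega quadrant (@phi R)) /\
  [/\ forall c : R, 0 < c ->
        exists2 C, is_ellipse C &
          is_quadrant_arc_of C (@phi R @` [set p | Omega p /\ p.1 = c]),
      forall c : R, c < 0 ->
        exists2 C, is_hyperbola_branch C &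
          is_quadrant_arc_of C (@phi R @` [set p | Omega p /\ p.2 = c]),
      forall c : R, 0 < c ->
        exists2 C, is_hyperbolic_pencil_circle C &
          is_quadrant_arc_of C (@phi R @` [set p | Omega p /\ p.1 - p.2 = c])
    & forall c : R, exists a : R,
        @phi R @` [set p | Omega p /\ p.1 + p.2 = c]
          = vertical_line a `&` quadrant].
Proof.
split; first by split; [exact: phi_quadrant|exact: phi_surj].
split.
- exact: vertical_ray_arc.
- exact: horizontal_ray_arc.
- exact: diagonal_segment_arc.
- by move=> c; exists (expR c); exact: antidiagonal_ray_image.
Qed.
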